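(* Let $p_1,\dots,p_m$ be distinct primes and let $k_1,\dots,k_m$ be positive integers. An affine latin rumple of order $p_1^{k_1}\cdots p_m^{k_m}$ exists if and only if $p_i$ divides $k_i$ for every $1\le i\le m$.
   Context: A left quasigroup is a binary algebra $(X,\cdot)$ in which all left translations $L_x:y\mapsto x\cdot y$ are bijections of $X$; a quasigroup is one in which also all right translations $R_x:y\mapsto y\cdot x$ are bijections. A rumple is a left quasigroup whose squaring map $x\mapsto x\cdot x$ is a bijection and which satisfies $(x\cdot y)\cdot(x\cdot z)=(y\cdot x)\cdot(y\cdot z)$ for all $x,y,z$. A latin rumple is a rumple that is a quasigroup. A binary algebra $(G,* )$ is affine if there exist an abelian group structure $(G,+)$ on $G$, endomorphisms $\varphi,\psi$ of $(G,+)$ and $c\in G$ such that $x*y=\varphi(x)+\psi(y)+c$ for all $x,y\in G$. The order of an algebra is the cardinality of its underlying set. *)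

(* Defs.v *)
From HB Require Import structures.
From mathcomp Require Import all_boot all_algebra.

Set Implicit Arguments.
Unset Strict Implicit.
Unset Printing Implicit Defensive.

Import GRing.Theory.

Section BinaryAlgebras.

Variables (X : Type) (op : X -> X -> X).

Definition left_quasigroup : Prop := forall x, bijective (op x).

Definition quasigroup : Prop :=
  left_quasigroup /\ (forall x, bijective (op^~ x)).

Definition rumple : Prop :=
  [/\ left_quasigroup,
      bijective (fun x => op x x)
    & forall x y z, op (op x y) (op x z) = op (op y x) (op y z)].

Definition latin_rumple : Prop := rumple /\ quasigroup.

End BinaryAlgebras.

(* [zmodG] is an abelian group structure on [G] itself, so that the carrier of
   [V] is [G]. The class also bundles decidable equality and a choice operator,
   which are always available when [G] is a finType. *)
Definition affine (G : Type) (op : G -> G -> G) : Prop :=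
  exists zmodG : GRing.Zmodule G,
    let V : zmodType := GRing.Zmodule.Pack zmodG in
    exists (phi psi : {additive V -> V}) (c : V),
      forall x y : V, op x y = (phi x + psi y + c)%R.

(* Main.v *)
(** The operation x * y = f x + g y + c satisfies the rumple identity iff
    f^2 + g f = f g.  When f is invertible this reads 1 + g f^-1 = f^-1 g, the
    relation of the Weyl algebra; taking traces on an F_p-space of dimension n
    gives n = 0 in F_p.  For an abelian p-group G one applies this to the
    subgroup of elements of order dividing p, which is invariant under f and g,
    and proceeds by induction with the subgroup p G, since
    #|G| = #|Ohm_1 G| * #|Mho^1 G|.
    Conversely, f = shift and g = 1 + x * shift on the functions F_p -> F_p
    give an example of order p ^ p, and examples are closed under direct
    products. *)
From HB Require Import structures.
Require Import Defs.
From mathcomp Require Import all_boot all_algebra all_fingroup all_solvable.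
From mathcomp Require Import mxabelem.

Set Implicit Arguments.
Unset Strict Implicit.
Unset Printing Implicit Defensive.

Import GRing.Theory.

Section WeylPair.

Local Open Scope group_scope.

Variables (gT : finGroupType) (D : {group gT}) (f g : {morphism D >-> gT}).

(** The domain [D] is kept apart from [G] so that the same [f] and [g] can be restricted to
    subgroups. *)
Definition weyl_pair (G : {set gT}) :=
  [/\ f @* G \subset G, g @* G \subset G, {in G &, injective f}
    & {in G, forall x, f (f x) * g (f x) = f (g x)}].

(** The condition on all [h] is full invariance; for abelian [G] it serves ['Ohm_1(G)], ['Mho^1(G)]
    and ['O_p(G)]. *)
Lemma weyl_pairS (G H : {set gT}) :
    H \subset G ->
    (forall h : {morphism D >-> gT}, h @* G \subset G -> h @* H \subset H) ->
  weyl_pair G -> weyl_pair H.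
Proof.
move=> /subsetP sHG stabH [fG gG injf fg]; split; rewrite ?stabH //.
  by move=> x y Hx Hy; apply: injf; apply: sHG.
by move=> x Hx; apply/fg/sHG.
Qed.

Lemma abelem_weyl_pair p (E : {group gT}) :
    E \subset D -> prime p -> p.-abelem E -> weyl_pair E -> p %| logn p #|E|.
Proof.
move=> sED p_pr abelE [fE gE injf fg].
have [-> | ntE] := eqVneq E 1%G; first by rewrite cards1 logn1.
have closed (h : {morphism D >-> gT}) x :
    h @* E \subset E -> x \in E -> h x \in E.
  by move=> /subsetP hE Ex; apply/hE/mem_morphim; rewrite // (subsetP sED).
pose rV := abelem_rV abelE ntE; pose E_ := rVabelem abelE ntE.
have E_E u : E_ u \in E := mem_rVabelem abelE ntE u.
have lin (h : {morphism D >-> gT}) :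
    h @* E \subset E -> linear (fun u => rV (h (E_ u))).
  move=> hE a u v; have hE_ w: h (E_ w) \in E by apply: closed.
  have DE_ w: E_ w \in D by rewrite (subsetP sED).
  rewrite /rV /E_ rVabelemD rVabelemZ morphM ?morphX ?groupX //.
  by rewrite abelem_rV_M ?groupX // abelem_rV_X // natr_Zp.
pose M (h : {morphism D >-> gT}) := lin1_mx (fun u => rV (h (E_ u))).
have ME (h : {morphism D >-> gT}) u : h @* E \subset E ->
    (u *m M h)%R = rV (h (E_ u)).
  move=> hE.
  pose L := GRing.isLinear.Build _ _ _ _ (fun u => rV (h (E_ u))) (lin h hE).
  pose hL : {linear _ -> _} := HB.pack (fun u => rV (h (E_ u))) L.
  exact: (mul_rV_lin1 hL).
have unitF : M f \in unitmx.
  rewrite -row_free_unit; apply/inj_row_free => u; rewrite ME // => rfu0.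
  apply: (can_inj (rVabelemK abelE ntE)); rewrite rVabelem0 -[LHS]/(E_ u).
  apply: injf; rewrite ?group1 // morph1.
  have fEu : f (E_ u) \in E by rewrite closed.
  by rewrite -(abelem_rV_K abelE ntE fEu) -/rV rfu0 rVabelem0.
(* Matrices act on row vectors from the right, which reverses the order of composition. *)
have weylM : (M f *m M f + M f *m M g = M g *m M f)%R.
  apply/row_matrixP => i; rewrite !rowE mulmxDr !mulmxA !ME //.
  have EK x : x \in E -> E_ (rV x) = x by apply: abelem_rV_K.
  by rewrite !EK ?closed // -fg // /rV abelem_rV_M ?closed.
(* Multiply [weylM] by [invmx (M f)] on both sides. Cyclicity of the trace then leaves only the
   trace of [1%:M], the dimension, which must vanish in ['F_p]. *)
have : (\tr (1%:M + M g *m invmx (M f)) = \tr (invmx (M f) *m M g))%R.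
  congr (\tr _)%R; rewrite -[RHS](mulmxK unitF) -(mulmxA _ (M g)) -weylM.
  by rewrite mulmxDr !mulKmx // mulmxDl mulmxV.
rewrite mxtraceD mxtrace1 [X in (_ + X)%R]mxtrace_mulC.
move/(canRL (addrK _)); rewrite subrr => /eqP.
have chFp := pchar_Fp p_pr.
by rewrite -(dvdn_pcharf chFp) (dim_abelemE abelE ntE).
Qed.

Lemma pgroup_weyl_pair p (G : {group gT}) :
    G \subset D -> prime p -> p.-group G -> abelian G -> weyl_pair G ->
  p %| logn p #|G|.
Proof.
move=> + p_pr; have [n] := ubnP #|G|.
elim: n G => // n IHn G /ltnSE-leGn sGD pG cGG wG.
have [G1 | ntG] := eqVneq G 1%G; first by rewrite G1 cards1 logn1.
have sOhm := Ohm_sub 1 G; have sMho := Mho_sub 1 G.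
have wOhm : weyl_pair 'Ohm_1(G).
  apply: weyl_pairS sOhm _ wG => h hG.
  exact: subset_trans (morphim_Ohm _ _ sGD) (OhmS _ hG).
have wMho : weyl_pair 'Mho^1(G).
  apply: weyl_pairS sMho _ wG => h hG.
  by rewrite morphim_Mho // MhoS.
have cardG := mul_card_Ohm_Mho_abelian 1 cGG.
rewrite -cardG lognM ?cardG_gt0 // dvdn_add //.
  apply: abelem_weyl_pair wOhm; rewrite ?(subset_trans sOhm) //.
  exact: Ohm1_abelem.
apply: IHn wMho; rewrite ?(subset_trans sMho) ?(pgroupS sMho) ?(abelianS sMho) //.
(* The order drops strictly because ['Ohm_1(G)] is nontrivial when [G] is. *)
apply: leq_trans leGn; rewrite -cardG ltn_Pmull ?cardG_gt0 //.
by rewrite cardG_gt1 Ohm1_eq1.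
Qed.

(** The Sylow subgroup ['O_p(G)] carries the whole [p]-part of the order, and morphisms send
    [p]-groups to [p]-groups. *)
Lemma abelian_weyl_pair p (G : {group gT}) :
    G \subset D -> prime p -> abelian G -> weyl_pair G -> p %| logn p #|G|.
Proof.
move=> sGD p_pr cGG wG.
have sO := pcore_sub p G.
have hallO : p.-Hall(G) 'O_p(G) by apply/nilpotent_pcore_Hall/abelian_nil.
rewrite -logn_part -(card_Hall hallO).
apply: pgroup_weyl_pair; rewrite ?(subset_trans sO) ?(abelianS sO) //.
  exact: pcore_pgroup.
apply: (weyl_pairS sO) wG => h hG.
rewrite (sub_Hall_pcore hallO) /= ?morphim_pgroup ?pcore_pgroup //.
exact: subset_trans (morphimS h sO) hG.
Qed.

End WeylPair.

(** Affine latin rumples stripped of their constant term; [affine_latin_rumpleP] shows that their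
    orders are exactly these [n]. *)
Definition weyl_order n :=
  exists (V : finZmodType) (phi psi : {additive V -> V}),
    [/\ injective phi, injective psi,
        forall x, (phi (phi x) + psi (phi x) = phi (psi x))%R & #|V| = n].

Lemma weyl_order_logn p n : prime p -> weyl_order n -> p %| logn p n.
Proof.
move=> p_pr [V [phi [psi [phiI _ weyl <-]]]].
have mor (h : {additive V -> V}) :
    {in [set: V] &, {morph h : x y / x * y >-> x * y}}%g.
  by move=> x y _ _; apply: raddfD.
rewrite -cardsT.
apply: (@abelian_weyl_pair _ _ (Morphism (mor phi)) (Morphism (mor psi))) => //.
  exact: FinRing.zmod_abelian.
split; rewrite ?subsetT //.
  by move=> x y _ _; apply: phiI.
by move=> x _; apply: weyl.
Qed.

Lemma weyl_order1 : weyl_order 1.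
Proof.
exists 'I_1, idfun, idfun; split=> // [x|]; last exact: card_ord.
by rewrite [LHS]ord1 [RHS]ord1.
Qed.

Lemma weyl_orderM n1 n2 : weyl_order n1 -> weyl_order n2 -> weyl_order (n1 * n2).
Proof.
move=> [V1 [phi1 [psi1 [phi1I psi1I weyl1 <-]]]].
move=> [V2 [phi2 [psi2 [phi2I psi2I weyl2 <-]]]].
pose W : finZmodType := HB.pack (V1 * V2)%type.
pose prod (f : {additive V1 -> V1}) (g : {additive V2 -> V2}) (x : W) : W :=
  (f x.1, g x.2).
have prodB f g : zmod_morphism (prod f g).
  by move=> x y; rewrite /prod !raddfB.
pose prodA f g : {additive W -> W} :=
  HB.pack (prod f g) (GRing.isZmodMorphism.Build W W (prod f g) (prodB f g)).
exists W, (prodA phi1 phi2), (prodA psi1 psi2); split.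
- by move=> [x1 x2] [y1 y2] [/phi1I-> /phi2I->].
- by move=> [x1 x2] [y1 y2] [/psi1I-> /psi2I->].
- by move=> [x1 x2]; congr (_, _); [apply: weyl1 | apply: weyl2].
exact: card_prod.
Qed.

Lemma weyl_order_prime p : prime p -> weyl_order (p ^ p).
Proof.
move=> p_pr; pose V : finZmodType := HB.pack {ffun 'F_p -> 'F_p}.
pose phi (u : V) : V := [ffun j => u (j + 1)%R].
pose psi (u : V) : V := [ffun j => u j + j * u (j + 1)]%R.
have phiB : zmod_morphism phi by move=> u v; apply/ffunP=> j; rewrite !ffunE.
have psiB : zmod_morphism psi.
  by move=> u v; apply/ffunP=> j; rewrite !ffunE mulrBr addrACA -opprD.
pose phiA : {additive V -> V} :=
  HB.pack phi (GRing.isZmodMorphism.Build V V phi phiB).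
pose psiA : {additive V -> V} :=
  HB.pack psi (GRing.isZmodMorphism.Build V V psi psiB).
exists V, phiA, psiA; split=> /=.
- move=> u v /ffunP equv; apply/ffunP => j.
  by have := equv (j - 1)%R; rewrite !ffunE subrK.
- apply: (raddf_inj (f := psiA)) => u /ffunP psiu0; apply/ffunP => j.
  (* u j = - j * u (j + 1) vanishes at j = 0, then at - 1, - 2, and so on *)
  have uNn n : u (- n%:R)%R = 0%R.
    elim: n => [|n IHn]; have := psiu0; first move/(_ 0%R).
      by rewrite !ffunE mul0r addr0 oppr0.
    move/(_ (- n.+1%:R)%R); rewrite !ffunE -[(n.+1)]addn1 natrD opprD subrK IHn.
    by rewrite mulr0 addr0.
  by rewrite ffunE -[j]opprK -[(- j)%R]natr_Zp.
(* At [j], both sides equal [u (j + 1) + (j + 1) * u (j + 2)]. *)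
- move=> u; apply/ffunP => j; rewrite !ffunE.
  by rewrite mulrDl mul1r addrCA [(j * _ + _)%R]addrC.
by rewrite card_ffun card_Fp.
Qed.

Lemma affine_latin_rumpleP n :
  (exists (X : finType) (op : X -> X -> X),
      [/\ latin_rumple op, affine op & #|X| = n])
  <-> weyl_order n.
Proof.
split=> [[X [op [[[Lop _ rop] [_ Rop]] [zV [phi [psi [c opE]]]] <-]]]|].
  pose V : zmodType := GRing.Zmodule.Pack zV.
  (* The eqType and choiceType of V may differ from those of the finType X, so
     the additive structure is transported to X. *)
  pose Z := GRing.isZmodule.Build X (@addrA V) (@addrC V) (@add0r V) (@addNr V).
  pose W : finZmodType := HB.pack X Z.
  have phiD : @zmod_morphism W W phi by move=> x y; apply: (raddfB phi).
  have psiD : @zmod_morphism W W psi by move=> x y; apply: (raddfB psi).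
  pose phiA : {additive W -> W} :=
    HB.pack (phi : W -> W) (GRing.isZmodMorphism.Build W W phi phiD).
  pose psiA : {additive W -> W} :=
    HB.pack (psi : W -> W) (GRing.isZmodMorphism.Build W W psi psiD).
  exists W, phiA, psiA.
  split; last exact: (@bij_eq_card W X id (inv_bij (fun=> erefl))).
  - move=> x y eqxy; apply: (bij_inj (Rop (0%R : V))).
    have {}eqxy : phi x = phi y := eqxy.
    by rewrite /= !opE eqxy.
  - move=> x y eqxy; apply: (bij_inj (Lop (0%R : V))).
    have {}eqxy : psi x = psi y := eqxy.
    by rewrite !opE eqxy.
  (* At [y = z = 0] both sides of the rumple identity contain [phi c + psi c + c], which cancels. *)
  - move=> x; have := rop x (0%R : V) (0%R : V).
    rewrite !opE !raddfD !raddf0 !addr0 !add0r => /(@addIr V).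
    by rewrite addrACA !addrA => /(@addIr V) /(@addIr V).
move=> [V [phi [psi [phiI psiI weyl cardV]]]].
have Lbij x : bijective (fun y => phi x + psi y)%R.
  by apply: injF_bij => y z /addrI /psiI.
have Rbij y : bijective (fun x => phi x + psi y)%R.
  by apply: injF_bij => x z /addIr /phiI.
exists V, (fun x y => phi x + psi y)%R; split=> //; last first.
  exists (GRing.Zmodule.class V), phi, psi, 0%R => x y.
  by rewrite addr0.
split; split=> //.
  (* phi + psi is the conjugate of psi by phi *)
  have [phi' _ phi'K] := injF_bij phiI.
  apply: injF_bij => x y.
  by rewrite -(phi'K x) -(phi'K y) !weyl => /phiI/psiI->.
(* Expanding [phi (psi y)] by [weyl] makes the left side symmetric in [x] and [y]. *)
move=> x y z; rewrite !raddfD -!weyl !addrA; congr (_ + _)%R.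
by rewrite addrAC [(phi (phi x) + _)%R]addrC.
Qed.

Theorem theorem4p11 (m : nat) (p k : 'I_m -> nat)
    (p_inj : injective p)
    (p_prime : forall i : 'I_m, prime (p i))
    (k_gt0 : forall i : 'I_m, 0 < k i) :
  (exists (X : finType) (op : X -> X -> X),
      [/\ latin_rumple op, affine op
        & #|X| = \prod_(i < m) p i ^ k i])
  <-> (forall i : 'I_m, p i %| k i).
Proof.
split=> [/affine_latin_rumpleP weylX i | p_dvd_k]; last first.
  apply/affine_latin_rumpleP.
  apply: (big_ind weyl_order weyl_order1 weyl_orderM) => i _.
  have /dvdnP[q ->] := p_dvd_k i.
  (* With [k i = q * p i], the factor is a product of [q] copies of [p i ^ p i]. *)
  elim: q => [|q IHq]; first exact: weyl_order1.
  by rewrite mulSn expnD; apply: weyl_orderM IHq; apply: weyl_order_prime.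
(* Since the primes are distinct, the factors with [j != i] are coprime to [p i]. *)
suff <- : logn (p i) (\prod_(j < m) p j ^ k j) = k i by apply: weyl_order_logn.
have pk_gt0 j : 0 < p j ^ k j by rewrite expn_gt0 prime_gt0.
rewrite (bigD1 i) //= lognM ?prodn_gt0 // pfactorK // logn_coprime ?addn0 //.
elim/big_ind: _ => [|x y cx cy|j ji]; rewrite ?coprimen1 ?coprimeMr ?cx //.
rewrite coprimeXr // prime_coprime // dvdn_prime2 //.
by apply: contra ji => /eqP /p_inj ->.
Qed.
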